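(* Let $\mathbb{X}$ be a uniformly convex real Banach space. Then $\Gamma(\mathbb{X})<\frac12$.
   Context: All normed spaces are real; $S_\mathbb{X}=\{x\in\mathbb{X}:\|x\|=1\}$. The modulus of convexity is $\delta_\mathbb{X}(\epsilon)=\inf\{1-\frac{\|x+y\|}{2}: x,y\in S_\mathbb{X},\ \|x-y\|\ge\epsilon\}$ for $\epsilon\in[0,2]$, and $\mathbb{X}$ is uniformly convex if $\delta_\mathbb{X}(\epsilon)>0$ whenever $\epsilon>0$. Birkhoff-James orthogonality: $x\perp_B y$ means $\|x+\lambda y\|\ge\|x\|$ for all $\lambda\in\mathbb{R}$. Norm derivatives: $\rho'_{\pm}(x,y)=\|x\|\lim_{t\to 0^{\pm}}\frac{\|x+ty\|-\|x\|}{t}$ and $\rho'(x,y)=\frac12(\rho'_+(x,y)+\rho'_-(x,y))$. The constant $\Gamma(\mathbb{X})$ is defined by $\Gamma(\mathbb{X})=\sup\{|\rho'(x,y)|: x,y\in S_\mathbb{X},\ x\perp_B y\}$. *)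

(* Defs.v *)
From mathcomp Require Import all_boot all_order all_algebra.
From mathcomp Require Import all_classical all_reals all_analysis.

Set Implicit Arguments.
Unset Strict Implicit.
Unset Printing Implicit Defensive.

Import Order.TTheory GRing.Theory Num.Theory.
Import numFieldNormedType.Exports.

Local Open Scope classical_set_scope.
Local Open Scope ring_scope.

Definition unit_sphere (R : realType) (X : normedModType R) : set X :=
  [set x | `|x| = 1].

(* The infimum is taken in the extended reals, so that it is +oo (and not the
   default value 0) over an empty set; this only occurs for e in [0, 2] when
   X is the zero space. *)
Definition modulus_of_convexity (R : realType) (X : normedModType R) (e : R)
    : \bar R :=
  ereal_inf [set r | exists x y : X,
    [/\ unit_sphere x, unit_sphere y, e <= `|x - y|
      & r = (1 - `|x + y| / 2)%:E]].

Definition uniformly_convex (R : realType) (X : normedModType R) : Prop :=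
  forall e : R, 0 < e -> e <= 2 -> (0 < modulus_of_convexity X e)%E.

Definition birkhoff_james (R : realType) (X : normedModType R) (x y : X)
    : Prop :=
  forall l : R, `|x| <= `|x + l *: y|.

(* The one-sided limits below always exist: by convexity of the norm, the
   difference quotient is nondecreasing in t, and it is bounded by `|y|. *)
Definition norm_deriv_right (R : realType) (X : normedModType R) (x y : X)
    : R :=
  `|x| * lim ((`|x + t *: y| - `|x|) / t @[t --> (0 : R)^'+]).

Definition norm_deriv_left (R : realType) (X : normedModType R) (x y : X)
    : R :=
  `|x| * lim ((`|x + t *: y| - `|x|) / t @[t --> (0 : R)^'-]).

Definition norm_deriv (R : realType) (X : normedModType R) (x y : X) : R :=
  (norm_deriv_right x y + norm_deriv_left x y) / 2.

(* The supremum is taken in the extended reals; it is -oo when X has dimension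
   at most 1, where no two unit vectors are orthogonal. *)
Definition Gamma (R : realType) (X : normedModType R) : \bar R :=
  ereal_sup [set r | exists x y : X,
    [/\ unit_sphere x, unit_sphere y, birkhoff_james x y
      & r = `|norm_deriv x y|%:E]].

(* Main.v *)
(** If [x] and [y] are orthogonal unit vectors, then [`|x - y| >= 1], so uniform
    convexity gives [`|x + y| <= 2 - 2 d] with [d > 0] a lower bound of the
    modulus of convexity at [1].  The difference quotient of the norm being
    nondecreasing, [0 <= rho'_+ x y <= `|x + y| - 1 <= 1 - 2 d]; applied to
    [- y] this also gives [-(1 - 2 d) <= rho'_- x y <= 0].  Hence
    [`|rho' x y| <= 1/2 - d]. *)

Require Import Defs.
From mathcomp Require Import all_boot all_order all_algebra.
From mathcomp Require Import all_classical all_reals all_analysis.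
From mathcomp Require Import lra.

Set Implicit Arguments.
Unset Strict Implicit.
Unset Printing Implicit Defensive.

Import Order.TTheory GRing.Theory Num.Theory.
Import numFieldNormedType.Exports.

Local Open Scope ring_scope.

(** Convexity of the norm: [x + s *: y] is the convex combination of [x] and [x + t *: y] with
    weights [1 - s / t] and [s / t]. The proof multiplies through by [t]. *)
Lemma norm_slope_le (R : realType) (X : normedModType R) (x y : X) (s t : R) :
  0 < s -> s <= t -> (`|x + s *: y| - `|x|) / s <= (`|x + t *: y| - `|x|) / t.
Proof.
move=> s0 st; have t0 := lt_le_trans s0 st.
rewrite ler_pdivrMr// mulrAC ler_pdivlMr//.
have e : t *: (x + s *: y) = (t - s) *: x + s *: (x + t *: y).
  by rewrite !scalerDr !scalerA scalerBl addrA subrK (mulrC s).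
have := ler_normD ((t - s) *: x) (s *: (x + t *: y)).
rewrite -e !normrZ (gtr0_norm t0) (gtr0_norm s0) ger0_norm ?subr_ge0//.
lra.
Qed.

Lemma is_cvg_norm_slope (R : realType) (X : normedModType R) (x y : X) :
  cvg ((`|x + t *: y| - `|x|) / t @[t --> (0 : R)^'+])%classic.
Proof.
apply: nondecreasing_at_right_is_cvgr; near=> b.
  move=> s t; rewrite !in_itv/= => /andP[s0 _] _ st.
  exact: norm_slope_le.
(* This bound is the triangle inequality for [x = (x + t *: y) - t *: y]. *)
exists (- `|y|) => _ [t /= + <-]; rewrite in_itv/= => /andP[t0 _].
rewrite ler_pdivlMr//.
have := ler_normB (x + t *: y) (t *: y).
by rewrite addrK normrZ gtr0_norm//; lra.
Unshelve. all: by end_near. Qed.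

(** The substitution of [- t] for [t] swaps the two one-sided limits, so bounds on right derivatives
    suffice. *)
Lemma norm_deriv_leftE (R : realType) (X : normedModType R) (x y : X) :
  norm_deriv_left x y = - norm_deriv_right x (- y).
Proof.
rewrite /norm_deriv_left /norm_deriv_right -mulrN; congr (_ * _).
apply: cvg_lim => //; apply/cvg_at_leftNP; rewrite oppr0.
rewrite (_ : _ \o _ = fun t : R => - ((`|x + t *: (- y)| - `|x|) / t)).
  by apply: cvgN; exact: is_cvg_norm_slope.
by apply/funext => t /=; rewrite scaleNr scalerN invrN mulrN.
Qed.

Lemma norm_deriv_right_le (R : realType) (X : normedModType R) (x y : X) :
  norm_deriv_right x y <= `|x| * (`|x + y| - `|x|).
Proof.
apply: ler_wpM2l => //; apply: limr_le; first exact: is_cvg_norm_slope.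
(* Slopes at small [t] are at most the slope at [1]. *)
near=> t.
have := @norm_slope_le _ _ x y t 1; rewrite scale1r divr1; apply => //.
by near: t; exact: nbhs_right_le.
Unshelve. all: by end_near. Qed.

Lemma birkhoff_james_norm_deriv_right_ge0 (R : realType) (X : normedModType R)
  (x y : X) : birkhoff_james x y -> 0 <= norm_deriv_right x y.
Proof.
move=> xy; apply: mulr_ge0 => //.
apply: limr_ge; first exact: is_cvg_norm_slope.
near=> t; rewrite divr_ge0 ?subr_ge0//.
Unshelve. all: by end_near. Qed.

Lemma birkhoff_jamesN (R : realType) (X : normedModType R) (x y : X) :
  birkhoff_james x y -> birkhoff_james x (- y).
Proof. by move=> xy l; rewrite scalerN -scaleNr. Qed.

Lemma uniformly_convex_birkhoff_james (R : realType) (X : normedModType R) :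
  uniformly_convex X -> exists2 d : R, 0 < d &
    forall x y : X, unit_sphere x -> unit_sphere y -> birkhoff_james x y ->
      `|x + y| <= 2 - 2 * d.
Proof.
move=> /(_ 1 ltr01) => /(_ (ler1n _ 2)).
set m := modulus_of_convexity _ _ => m0.
have [d d0 dm] : exists2 d : R, 0 < d & (d%:E <= m)%E.
  (* The infimum is [+oo] in the zero space, where any positive [d] will do. *)
  case: m m0 => [r r0|_|//]; first by exists r.
  by exists 1 => //; rewrite leey.
exists d => // x y x1 y1 xy.
have : (d%:E <= (1 - `|x + y| / 2)%:E)%E.
  apply: (le_trans dm); apply: ereal_inf_lbound; exists x, y; split => //.
  (* Orthogonality at [l = -1] makes the pair admissible for the modulus at [1]. *)
  by have := xy (-1); rewrite scaleN1r x1.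
by rewrite lee_fin; lra.
Qed.

Theorem theorem2p12 (R : realType) (X : completeNormedModType R) :
  uniformly_convex X -> (Gamma X < (1 / 2 : R)%:E)%E.
Proof.
move=> /uniformly_convex_birkhoff_james[d d0 dP].
(* The gap [d] is uniform in the pair, so the inequality stays strict after the supremum. *)
apply: (@le_lt_trans _ _ (1 / 2 - d)%:E); last by rewrite lte_fin; lra.
apply: ge_ereal_sup => _ [x [y [x1 y1 xy ->]]].
have y1' : unit_sphere (- y) by rewrite /unit_sphere/= normrN.
have xy' := birkhoff_jamesN xy.
have := birkhoff_james_norm_deriv_right_ge0 xy.
have := birkhoff_james_norm_deriv_right_ge0 xy'.
have := norm_deriv_right_le x y; have := norm_deriv_right_le x (- y).
have := dP _ _ x1 y1 xy; have := dP _ _ x1 y1' xy'.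
(* The value is now half the difference of two numbers in [[0, 1 - 2 * d]]. *)
rewrite x1 !mul1r lee_fin ler_norml /norm_deriv norm_deriv_leftE => *.
by apply/andP; split; lra.
Qed.
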